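(* Let $n\ge 1$ be an integer, let $\omega_0,\dots,\omega_n>0$, and let $\Delta_i\in\mathbb{R}^d$ for $0\le i\le n-1$, with $d$ a fixed dimension. Then the quantity $$B=n\left(\max_{0\le i\le n-1}q_i\right)\left(\max_{0\le i\le n-1}\|\Delta_i\|\right),\qquad q_i=\max\left\{\frac{\omega_{i+1}}{\omega_i},\frac{\omega_i}{\omega_{i+1}}\right\},$$ can be computed from the $\omega_i$ and $\Delta_i$ in $\mathcal{O}(n)$ time. Moreover, the maximal adjacent weight ratio $\Omega=\max_{0\le i\le n-1}q_i$ is obtained in the same pass over $i=0,\dots,n-1$.
   Context: $\|\cdot\|$ is the Euclidean norm on $\mathbb{R}^d$. Time is counted in elementary real operations (arithmetic operations, comparisons, and evaluation of the norm of a vector in $\mathbb{R}^d$ with $d$ fixed, each at unit cost). *)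

(* Defs.v *)
From HB Require Import structures.
From mathcomp Require Import all_boot all_order all_algebra.
From mathcomp Require Import reals.

Set Implicit Arguments.
Unset Strict Implicit.
Unset Printing Implicit Defensive.

Import Order.TTheory GRing.Theory Num.Theory.

Local Open Scope ring_scope.

(* MathComp-Analysis' norm `|v| on row vectors is the sup norm, hence this. *)
Definition enorm (R : realType) (d : nat) (v : 'rV[R]_d) : R :=
  Num.sqrt (\sum_(j < d) v 0 j ^+ 2).

(* With omega = (w_0, ..., w_n) and i < n, [widen_ord (leqnSn n) i] is the
   index i and [lift ord0 i] is the index i + 1. *)
Definition weight_ratio (R : realType) (n : nat) (omega : 'I_n.+1 -> R)
    (i : 'I_n) : R :=
  let w := omega (widen_ord (leqnSn n) i) in
  let w' := omega (lift ord0 i) in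
  Num.max (w' / w) (w / w').

(* The families maximised below are nonnegative and (for n >= 1) nonempty, so
   starting the maximum from 0 does not affect its value. *)
Definition max_weight_ratio (R : realType) (n : nat) (omega : 'I_n.+1 -> R)
    : R :=
  \big[Num.max/0]_(i < n) weight_ratio omega i.

Definition boundB (R : realType) (n d : nat) (omega : 'I_n.+1 -> R)
    (Delta : 'I_n -> 'rV[R]_d) : R :=
  n%:R * max_weight_ratio omega * \big[Num.max/0]_(i < n) enorm (Delta i).

(* A random access machine over the reals.  Programs are finite syntax that
   mentions neither R, nor the input length n, nor the input data.  Real
   registers and loop counters are named by natural numbers. *)

Inductive input_index :=
| IConst of nat
| IShift of nat & nat. (* IShift x k : value of the loop counter x, plus k *)

Inductive operand :=
| OReg of nat
| OConst of nat
| OWeight of input_index.   (* the input weight at that index *)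

Inductive arith := Add | Sub | Mul | Div.

Inductive cmd :=
| Skip
| Copy of nat & operand                    (* r := a *)
| Arith of nat & arith & operand & operand (* r := a op b *)
| Norm of nat & input_index                (* r := ||Delta_e|| *)
| IfLe of operand & operand & cmd & cmd    (* if a <= b then _ else _ *)
| Seq of cmd & cmd
| For of nat & cmd.                        (* for x = 0, ..., n - 1 do _ *)

Fixpoint loop_free (c : cmd) : bool :=
  match c with
  | Skip | Copy _ _ | Arith _ _ _ _ | Norm _ _ => true
  | IfLe _ _ c1 c2 | Seq c1 c2 => loop_free c1 && loop_free c2
  | For _ _ => false
  end.

Record state (R : realType) := State { reg : nat -> R; ctr : nat -> nat }.

Definition init_state (R : realType) : state R :=
  State (fun=> 0) (fun=> 0%N).

Definition upd (T : Type) (f : nat -> T) (k : nat) (v : T) : nat -> T :=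
  fun j => if j == k then v else f j.

Definition set_reg (R : realType) (s : state R) (r : nat) (v : R) : state R :=
  State (upd (reg s) r v) (ctr s).

Definition set_ctr (R : realType) (s : state R) (x i : nat) : state R :=
  State (reg s) (upd (ctr s) x i).

Section Semantics.

Variables (R : realType) (n d : nat).
Variables (omega : 'I_n.+1 -> R) (Delta : 'I_n -> 'rV[R]_d).

Definition eval_index (s : state R) (e : input_index) : nat :=
  match e with
  | IConst k => k
  | IShift x k => (ctr s x + k)%N
  end.

(* Reading the input out of bounds is an error ([None]). *)
Definition eval_operand (s : state R) (a : operand) : option R :=
  match a with
  | OReg r => Some (reg s r)
  | OConst k => Some k%:R
  | OWeight e => omap omega (insub (eval_index s e))
  end.

(* Dividing by zero is an error. *)
Definition eval_arith (op : arith) (u v : R) : option R :=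
  match op with
  | Add => Some (u + v)
  | Sub => Some (u - v)
  | Mul => Some (u * v)
  | Div => if v == 0 then None else Some (u / v)
  end.

(* [run c s] is [Some (s', t)] if c, started in s, terminates without error in
   s' after time t.  Arithmetic operations, comparisons and norm evaluations
   cost one unit each; copies, the entry into a loop and every loop iteration
   are charged one unit as well, so t also bounds the bookkeeping. *)
Fixpoint run (c : cmd) (s : state R) : option (state R * nat) :=
  match c with
  | Skip => Some (s, 0%N)
  | Copy r a =>
      if eval_operand s a is Some u then Some (set_reg s r u, 1%N) else None
  | Arith r op a b =>
      if (eval_operand s a, eval_operand s b) is (Some u, Some v) then
        if eval_arith op u v is Some w then Some (set_reg s r w, 1%N) else None
      else None
  | Norm r e =>
      if insub (eval_index s e) is Some i
      then Some (set_reg s r (enorm (Delta i)), 1%N) else None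
  | IfLe a b c1 c2 =>
      if (eval_operand s a, eval_operand s b) is (Some u, Some v) then
        if run (if u <= v then c1 else c2) s is Some (s', t)
        then Some (s', t.+1) else None
      else None
  | Seq c1 c2 =>
      if run c1 s is Some (s1, t1) then
        if run c2 s1 is Some (s2, t2) then Some (s2, (t1 + t2)%N) else None
      else None
  | For x c =>
      foldl (fun acc i =>
        if acc is Some (s1, t1) then
          if run c (set_ctr s1 x i) is Some (s2, t2)
          then Some (s2, (t1 + t2).+1) else None
        else None) (Some (s, 1%N)) (iota 0 n)
  end.

End Semantics.

(* Main.v *)
Require Import Defs.
From HB Require Import structures.
From mathcomp Require Import all_boot all_order all_algebra.
From mathcomp Require Import reals.
Import Order.TTheory GRing.Theory Num.Theory.
Local Open Scope ring_scope.

(* The else branch is a dummy copy rather than [Skip], so that time and final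
   state do not depend on the outcome of the comparison. *)
Definition max_into (r r' : nat) : cmd :=
  IfLe (OReg r) (OReg r') (Copy r (OReg r')) (Copy r (OReg r)).

(* Register 0 holds the running maximum of the weight ratios, register 1 that
   of the norms, register 2 is scratch and register 3 counts the iterations,
   since a program has no other access to n. *)
Definition scan_body : cmd :=
  let w := OWeight (IShift 0 0) in
  let w' := OWeight (IShift 0 1) in
  Seq (Seq (Arith 2 Div w' w) (max_into 0 2))
  (Seq (Seq (Arith 2 Div w w') (max_into 0 2))
  (Seq (Seq (Norm 2 (IShift 0 0)) (max_into 1 2))
       (Arith 3 Add (OReg 3) (OConst 1)))).

Definition combine : cmd :=
  Seq (Arith 4 Mul (OReg 3) (OReg 0)) (Arith 4 Mul (OReg 4) (OReg 1)).

(** Prefix maxima are filtered over the fixed type ['I_n] rather than indexed by ['I_k], so that [F]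
    never has to be restricted. Splitting off the index of value [k] leaves exactly the indices
    below [k]. *)
Lemma bigmax_ord_recr {R : realType} {n k : nat} {F : 'I_n -> R} (i : 'I_n) :
  i = k :> nat ->
  \big[Num.max/0]_(j < n | (j < k.+1)%N) F j =
  Num.max (\big[Num.max/0]_(j < n | (j < k)%N) F j) (F i).
Proof.
move=> ik; rewrite (bigmaxD1 i) ?ik ?ltnS // maxC; congr Num.max.
by apply: eq_bigl => j; rewrite -val_eqE /= ik ltnS [RHS]ltn_neqAle andbC.
Qed.

Section Scan.

Context {R : realType} {n d : nat}.
Context {omega : 'I_n.+1 -> R} {Delta : 'I_n -> 'rV[R]_d}.
Hypothesis omega_gt0 : forall i, 0 < omega i.

Lemma run_Seq {c1 c2 : cmd} {s s1 s2 : state R} (t1 t2 : nat) :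
  run omega Delta c1 s = Some (s1, t1) ->
  run omega Delta c2 s1 = Some (s2, t2) ->
  run omega Delta (Seq c1 c2) s = Some (s2, (t1 + t2)%N).
Proof. by move=> /= -> ->. Qed.

Lemma run_max_into (r r' : nat) (s : state R) :
  run omega Delta (max_into r r') s =
  Some (set_reg s r (Num.max (reg s r) (reg s r')), 2%N).
Proof. by rewrite /= maxEle; case: (_ <= _). Qed.

Lemma eval_weight (s : state R) (x k : nat) (i : 'I_n.+1) :
  (ctr s x + k)%N = i ->
  eval_operand omega s (OWeight (IShift x k)) = Some (omega i).
Proof. by move=> /= ->; rewrite valK. Qed.

Lemma run_Div {r : nat} {a b : operand} {u v : R} {s : state R} :
  eval_operand omega s a = Some u -> eval_operand omega s b = Some v ->
  v != 0 -> run omega Delta (Arith r Div a b) s = Some (set_reg s r (u / v), 1%N).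
Proof. by move=> /= -> -> /negPf ->. Qed.

Lemma run_Norm (r x k : nat) (s : state R) (i : 'I_n) :
  (ctr s x + k)%N = i ->
  run omega Delta (Norm r (IShift x k)) s =
  Some (set_reg s r (enorm (Delta i)), 1%N).
Proof. by move=> /= ->; rewrite valK. Qed.

Lemma run_scan_body (s : state R) (i : 'I_n) :
  ctr s 0%N = i ->
  exists s', [/\ run omega Delta scan_body s = Some (s', 10%N),
    reg s' 0%N = Num.max (reg s 0%N) (weight_ratio omega i),
    reg s' 1%N = Num.max (reg s 1%N) (enorm (Delta i))
    & reg s' 3%N = reg s 3%N + 1].
Proof.
move=> si; have w_neq0 j : omega j != 0 by rewrite gt_eqF.
(* Register writes leave the counters alone, so the weights can be read in this way from every
   intermediate state of the body. *)
have evw (s' : state R) : ctr s' = ctr s ->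
    eval_operand omega s' (OWeight (IShift 0 0)) =
    Some (omega (widen_ord (leqnSn n) i)).
  by move=> ss'; apply: eval_weight; rewrite ss' si addn0.
have evw' (s' : state R) : ctr s' = ctr s ->
    eval_operand omega s' (OWeight (IShift 0 1)) =
    Some (omega (lift ord0 i)).
  by move=> ss'; apply: eval_weight; rewrite ss' si addn1.
(* The final state is found by unification while the body is executed. The cost is 3 for each
   quotient and for the norm (one evaluation, then 2 for the maximum), plus 1 for the count. *)
eexists; split.
- apply: (run_Seq 3 7).
    by apply: (run_Seq 1 2 (run_Div _ _ _));
      [exact: evw'|exact: evw|exact: w_neq0|exact: run_max_into].
  apply: (run_Seq 3 4).
    by apply: (run_Seq 1 2 (run_Div _ _ _));
      [exact: evw|exact: evw'|exact: w_neq0|exact: run_max_into].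
  apply: (run_Seq 3 1); last by [].
  apply: (run_Seq 1 2 (run_Norm _ _ _ _ i _)).
    by rewrite /= si addn0.
  exact: run_max_into.
(* The two quotients enter the running maximum one after the other; associativity regroups them into
   [weight_ratio]. *)
- by rewrite /= /upd /= -maxA.
- by [].
- by [].
Qed.

(** Entering the loop costs 1, and each iteration costs 10 for the body plus 1 for the loop
    itself. *)
Lemma run_scan :
  exists s, [/\ run omega Delta (For 0 scan_body) (init_state R) =
      Some (s, (1 + 11 * n)%N),
    reg s 0%N = max_weight_ratio omega,
    reg s 1%N = \big[Num.max/0]_(i < n) enorm (Delta i)
    & reg s 3%N = n%:R].
Proof.
have full (F : 'I_n -> R) :
    \big[Num.max/0]_(j < n) F j = \big[Num.max/0]_(j < n | (j < n)%N) F j.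
  by apply: eq_bigl => j; rewrite ltn_ord.
rewrite /max_weight_ratio !full /run -/(@run R n d omega Delta).
set step := (X in foldl X).
(* Loop invariant after [k] iterations, with [n] fixed because the input types depend on it. The
   truncated maxima supplied by [full] make the goal its instance at [k = n]. *)
suff inv k : (k <= n)%N -> exists s,
    [/\ foldl step (Some (init_state R, 1%N)) (iota 0 k) =
          Some (s, (1 + 11 * k)%N),
      reg s 0%N = \big[Num.max/0]_(j < n | (j < k)%N) weight_ratio omega j,
      reg s 1%N = \big[Num.max/0]_(j < n | (j < k)%N) enorm (Delta j)
      & reg s 3%N = k%:R].
  exact: inv.
elim: k => [_|k IHk lt_kn].
  (* Empty maxima take the default value 0, which is also the initial content of the registers. *)
  by exists (init_state R); split; rewrite // big_pred0.
have [s [run_s s0 s1 s3]] := IHk (ltnW lt_kn).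
have [s' [run_s' s'0 s'1 s'3]] :=
  run_scan_body (set_ctr s 0 k) (Ordinal lt_kn) erefl.
exists s'; split.
- rewrite -[in iota 0 _](addn1 k) iotaD foldl_cat run_s add0n.
  rewrite -[LHS]/(step (Some (s, (1 + 11 * k)%N)) k) [LHS]/step run_s'.
  by rewrite -addnS -addnA -mulnSr.
- by rewrite s'0 /= s0 (bigmax_ord_recr (Ordinal lt_kn)).
- by rewrite s'1 /= s1 (bigmax_ord_recr (Ordinal lt_kn)).
- by rewrite s'3 /= s3 -natr1.
Qed.

End Scan.

Theorem lemma1 (R : realType) (d : nat) :
  exists (init body fin : cmd) (x rB rOmega C : nat),
    [/\ loop_free init, loop_free body, loop_free fin &
      forall (n : nat) (omega : 'I_n.+1 -> R) (Delta : 'I_n -> 'rV[R]_d),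
        (1 <= n)%N ->
        (forall i, 0 < omega i) ->
        exists (s1 s2 : state R) (t1 t2 : nat),
          [/\ run omega Delta (Seq init (For x body)) (init_state R)
                = Some (s1, t1),
              reg s1 rOmega = max_weight_ratio omega,
              run omega Delta (Seq (Seq init (For x body)) fin) (init_state R)
                = Some (s2, t2),
              reg s2 rB = boundB omega Delta
            & (t2 <= C * n)%N]].
Proof.
(* The total time is [11 * n + 3]: the scan, then the two products of [combine]. Since [1 <= n],
   this is at most [14 * n]. *)
exists Skip, scan_body, combine, 0%N, 4%N, 0%N, 14%N; split=> //.
move=> n omega Delta n_gt0 omega_gt0.
have [s [run_s s0 s1 s3]] := run_scan (Delta := Delta) omega_gt0.
have run_s1 : run omega Delta (Seq Skip (For 0 scan_body)) (init_state R) =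
    Some (s, (1 + 11 * n)%N).
  exact: (run_Seq 0 _ _ run_s).
exists s; eexists; exists (1 + 11 * n)%N, (1 + 11 * n + 2)%N; split=> //.
- exact: (run_Seq _ 2 run_s1).
- by rewrite /= /upd /= s0 s1 s3.
- by rewrite addnAC addnC (mulnDl 11 3) leq_add2l leq_pmulr.
Qed.
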